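(* Let $\mathcal T=(T_n)$ be a sequence of tournaments with $|V(T_n)|\to\infty$. If $\limsup_n t_4(T_n)<\frac12$, then $\mathcal T$ is $4$-universal. Moreover, $\liminf_n w_4(T_n)\ge\frac12-\limsup_n t_4(T_n)$ and $\liminf_n l_4(T_n)\ge\frac12-\limsup_n t_4(T_n)$. Also, if $\limsup_n t_4(T_n)\le\frac12$ then $\liminf_n c_4(T_n)\ge\frac16$. Finally, the sequence $\mathcal C$ of circular tournaments $C_n$ ($n$ odd) satisfies $\lim t_4(C_n)=\frac12$ and $\lim l_4(C_n)=\lim w_4(C_n)=0$.
   Context: For a fixed $l$-vertex tournament $H$ and a tournament $T$, $p(H,T)$ is the probability that a uniformly random $l$-subset of $V(T)$ induces a subtournament isomorphic to $H$. There are four $4$-vertex tournaments up to isomorphism: $T_4$, the transitive one; $C_4$, the unique strongly connected one; $W_4$, in which the three vertices of a cyclic triangle all point to the fourth vertex; and $L_4$, in which one vertex points to all three vertices of a cyclic triangle. Write $t_4(T)=p(T_4,T)$, $c_4(T)=p(C_4,T)$, $w_4(T)=p(W_4,T)$, $l_4(T)=p(L_4,T)$. A sequence of tournaments $(T_n)$ with $|V(T_n)|\to\infty$ is $l$-universal if $\liminf_n p(H,T_n)>0$ for every $l$-vertex tournament $H$. The circular tournament $C_n$ ($n$ odd) has $n$ vertices equally spaced on the unit circle, with $x\to y$ iff the clockwise arc from $x$ to $y$ is shorter than the counterclockwise arc. *)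

(* Defs.v *)
From mathcomp Require Import all_boot all_order all_algebra.
From mathcomp Require Import all_classical all_reals all_analysis.

Set Implicit Arguments.
Unset Strict Implicit.
Unset Printing Implicit Defensive.

Import Order.TTheory GRing.Theory Num.Theory.

Local Open Scope ring_scope.

Record tournament := Tournament {
  vertex :> finType;
  arc : rel vertex;
  arc_irr : irreflexive arc;
  arc_total : forall x y : vertex, x != y -> arc x y = ~~ arc y x }.

Definition isomorphic (H K : tournament) : Prop :=
  exists f : H -> K, bijective f /\ {mono f : x y / arc x y}.

Section Induced.
Variables (T : tournament) (S : {set T}).

Definition induced_arc : rel {x : T | x \in S} :=
  fun x y => arc (val x) (val y).

Lemma induced_arc_irr : irreflexive induced_arc.
Proof. by move=> x; apply: arc_irr. Qed.

Lemma induced_arc_total (x y : {x : T | x \in S}) :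
  x != y -> induced_arc x y = ~~ induced_arc y x.
Proof. by move=> xy; apply: arc_total. Qed.

Definition induced : tournament :=
  Tournament induced_arc_irr induced_arc_total.

End Induced.

(* If #|T| < #|H| the quotient is 0 / 0 = 0. *)
Definition density (R : realType) (H T : tournament) : R :=
  #|[set S : {set T} | (#|S| == #|H|) && `[< isomorphic H (induced S) >]]|%:R
  / 'C(#|T|, #|H|)%:R.

(* Sequences of densities are bounded, so their [limn_sup] and [limn_inf] are the
   genuine upper and lower limits. *)
Lemma density_ge0_le1 (R : realType) (H T : tournament) :
  0 <= density R H T <= 1.
Proof.
rewrite /density; set A := [set _ | _]; rewrite divr_ge0 ?ler0n //=.
have leA : (#|A| <= 'C(#|T|, #|H|))%N.
  rewrite -card_draws; apply: subset_leq_card.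
  by apply/fintype.subsetP => S; rewrite !inE => /andP[].
have [->|C0] := eqVneq 'C(#|T|, #|H|) 0%N; first by rewrite invr0 mulr0 ler01.
by rewrite ler_pdivrMr ?ltr0n ?lt0n // mul1r ler_nat.
Qed.

Definition universal (R : realType) (l : nat) (T : nat -> tournament) : Prop :=
  forall H : tournament, #|H| = l -> 0 < limn_inf (fun n => density R H (T n)).

Definition arcs_of (s : seq (nat * nat)) : rel 'I_4 :=
  fun i j => (nat_of_ord i, nat_of_ord j) \in s.

Definition T4_arc : rel 'I_4 := fun i j => (i < j)%N.

Lemma T4_irr : irreflexive T4_arc.
Proof. by move=> i; apply: ltnn. Qed.

Lemma T4_total i j : i != j -> T4_arc i j = ~~ T4_arc j i.
Proof. by move=> ij; rewrite /T4_arc -leqNgt ltn_neqAle ij. Qed.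

Definition T4 := Tournament T4_irr T4_total.

(* The cycle 0 -> 1 -> 2 -> 3 -> 0 and its two chords; see [C4_strong]. *)
Definition C4_arc : rel 'I_4 :=
  arcs_of [:: (0, 1); (1, 2); (2, 3); (3, 0); (0, 2); (1, 3)]%N.

Lemma C4_irr : irreflexive C4_arc.
Proof. by move=> [[|[|[|[|?]]]] ?]. Qed.

Lemma C4_total i j : i != j -> C4_arc i j = ~~ C4_arc j i.
Proof. by case: i j => [[|[|[|[|?]]]] ?] [[|[|[|[|?]]]] ?]. Qed.

Definition C4 := Tournament C4_irr C4_total.

Definition strongly_connected (T : tournament) : Prop :=
  forall x y : T, connect (@arc T) x y.

Lemma C4_strong : strongly_connected C4.
Proof.
pose o k : C4 := inord k.
have st k : connect (@arc C4) (o (k %% 4)%N) (o (k.+1 %% 4)%N).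
  have -> : (k.+1 %% 4 = (k %% 4).+1 %% 4)%N by rewrite -addn1 -modnDml addn1.
  apply: connect1; rewrite /o /= /C4_arc /arcs_of !inordK ?ltn_mod //.
  by have := ltn_pmod k (isT : 0 < 4)%N; case: (k %% 4)%N => [|[|[|[|]]]].
have it k d : connect (@arc C4) (o (k %% 4)%N) (o ((k + d) %% 4)%N).
  elim: d => [|d IH]; first by rewrite addn0.
  by rewrite addnS; apply: connect_trans IH (st _).
move=> x y; have := it x (4 - x + y)%N.
rewrite addnA subnKC ?(ltnW (ltn_ord x)) // modnDl !modn_small ?ltn_ord //.
by rewrite /o !inord_val.
Qed.

Definition W4_arc : rel 'I_4 :=
  arcs_of [:: (0, 1); (1, 2); (2, 0); (0, 3); (1, 3); (2, 3)]%N.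

Lemma W4_irr : irreflexive W4_arc.
Proof. by move=> [[|[|[|[|?]]]] ?]. Qed.

Lemma W4_total i j : i != j -> W4_arc i j = ~~ W4_arc j i.
Proof. by case: i j => [[|[|[|[|?]]]] ?] [[|[|[|[|?]]]] ?]. Qed.

Definition W4 := Tournament W4_irr W4_total.

Definition L4_arc : rel 'I_4 :=
  arcs_of [:: (0, 1); (1, 2); (2, 0); (3, 0); (3, 1); (3, 2)]%N.

Lemma L4_irr : irreflexive L4_arc.
Proof. by move=> [[|[|[|[|?]]]] ?]. Qed.

Lemma L4_total i j : i != j -> L4_arc i j = ~~ L4_arc j i.
Proof. by case: i j => [[|[|[|[|?]]]] ?] [[|[|[|[|?]]]] ?]. Qed.

Definition L4 := Tournament L4_irr L4_total.

Definition t4 (R : realType) (T : tournament) : R := density R T4 T.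
Definition c4 (R : realType) (T : tournament) : R := density R C4 T.
Definition w4 (R : realType) (T : tournament) : R := density R W4 T.
Definition l4 (R : realType) (T : tournament) : R := density R L4 T.

Section Circular.
Variable n : nat.
Hypothesis n_odd : odd n.

(* The vertices 0, ..., n - 1 are listed clockwise; [clockwise i j] is the
   length, in units of 2 pi / n, of the clockwise arc from i to j, so the
   counterclockwise arc from i to j has length [clockwise j i]. *)
Definition clockwise (i j : 'I_n) : nat := ((j + (n - i)) %% n)%N.

Definition circular_arc : rel 'I_n :=
  fun i j => (clockwise i j < clockwise j i)%N.

Lemma circular_arc_irr : irreflexive circular_arc.
Proof. by move=> i; apply: ltnn. Qed.

Lemma clockwiseE (i j : 'I_n) :
  clockwise i j = if (i <= j)%N then (j - i)%N else (j + (n - i))%N.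
Proof.
rewrite /clockwise; case: leqP => ij.
  rewrite addnBA ?(ltnW (ltn_ord i)) // addnC -addnBA // modnDl modn_small //.
  by rewrite (leq_ltn_trans (leq_subr _ _)).
rewrite modn_small // addnBA ?(ltnW (ltn_ord i)) // ltn_subLR.
  by rewrite ltn_add2r.
by rewrite (leq_trans (ltnW (ltn_ord i))) ?leq_addl.
Qed.

Lemma clockwise_add (i j : 'I_n) :
  i != j -> (clockwise i j + clockwise j i = n)%N.
Proof.
rewrite !clockwiseE neq_ltn => /orP[] ij; rewrite (ltnW ij) leqNgt ij /=.
  rewrite addnA subnK ?(ltnW ij) // subnKC //; exact/ltnW/ltn_ord.
rewrite addnC addnA subnK ?(ltnW ij) // subnKC //; exact/ltnW/ltn_ord.
Qed.

Lemma circular_arc_total i j :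
  i != j -> circular_arc i j = ~~ circular_arc j i.
Proof.
move=> ij; rewrite /circular_arc -leqNgt ltn_neqAle.
case: eqP => //= e; have := n_odd.
by rewrite -(clockwise_add ij) e addnn odd_double.
Qed.

Definition circular : tournament :=
  Tournament circular_arc_irr circular_arc_total.

End Circular.

Lemma odd_doubleS (k : nat) : odd k.*2.+1.
Proof. by rewrite /= odd_double. Qed.

(* The k-th odd number is 2k + 1. *)
Definition circular_seq (k : nat) : tournament := circular (odd_doubleS k).

(* Main.v *)
Require Import Defs.
From mathcomp Require Import all_boot all_order all_algebra.
From mathcomp Require Import all_classical all_reals all_analysis.
From mathcomp Require Import ring lra zify.

(* A 4-vertex tournament is determined up to isomorphism by whether it has a
   source and whether it has a sink: [T4] has both, [L4] only a source, [W4]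
   only a sink, [C4] neither.  Counting 4-sets with a source by that source
   gives t4 + l4 = (sum over v of C(d(v), 3)) / C(n, 4) with d the outdegree;
   by convexity this is at least 1/2 - O(1/n), and dually for t4 + w4.  For c4,
   an arc lying on k cyclic triangles is their common arc in C(k, 2) copies of
   [C4], and each copy of [C4] arises once.  Counting cyclic triangles, the mean
   of k is (n - 2) s / 4 with s = 2 c4 + l4 + w4 = 1 + c4 - t4, so convexity
   yields c4 >= 3/8 (1 + c4 - t4)^2 - O(1/n), whence c4 >= 1/6 - o(1) once
   t4 <= 1/2 + o(1).  Adding the first two bounds gives t4 >= c4 - o(1).
   In a circular tournament all in- and out-neighbourhoods are transitive, so
   l4 = w4 = 0, and all outdegrees are at most (n - 1) / 2, so t4 <= 1/2. *)

Set Implicit Arguments.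
Unset Strict Implicit.
Unset Printing Implicit Defensive.

Import Order.TTheory GRing.Theory Num.Theory.
Import numFieldNormedType.Exports.

Local Open Scope nat_scope.

(* Both names are shadowed by the libraries imported above. *)
Local Notation arc := Defs.arc.
Local Notation induced := Defs.induced.

(** * Classification of 4-vertex tournaments by source and sink *)

Definition coarc (T : tournament) : rel T := fun x y => arc y x.

(** With the arc relation this detects a source of [s], with the reversed relation a sink. Working
    on sequences over any [eqType] lets the same notion be computed on [iota 0 4] and applied to
    vertex sets. *)
Definition dominated (V : eqType) (e : rel V) (s : seq V) : bool :=
  has (fun v => all (fun u => (u == v) || e v u) s) s.

Lemma eq_dominated (V : eqType) (e : rel V) (s1 s2 : seq V) :
  s1 =i s2 -> dominated e s1 = dominated e s2.
Proof.
move=> es; rewrite /dominated (eq_has_r es).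
by apply: eq_has => v; apply: eq_all_r.
Qed.

Lemma dominated_map (V W : eqType) (e : rel V) (e' : rel W) (f : V -> W) s :
  {in s &, injective f} -> {in s &, forall x y, e' (f x) (f y) = e x y} ->
  dominated e' (map f s) = dominated e s.
Proof.
move=> fI fe; rewrite /dominated has_map; apply: eq_in_has => v vs /=.
rewrite all_map; apply: eq_in_all => u us /=.
by rewrite (inj_in_eq fI) // fe.
Qed.

Definition has_source (K : tournament) : bool := dominated (@arc K) (enum K).
Definition has_sink (K : tournament) : bool := dominated (@coarc K) (enum K).

Lemma isomorphic_sym H K : isomorphic H K -> isomorphic K H.
Proof.
case=> f [[g fK gK] fe]; exists g; split; first by exists f.
by move=> x y; rewrite -fe !gK.
Qed.

Lemma isomorphic_trans H K L :
  isomorphic H K -> isomorphic K L -> isomorphic H L.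
Proof.
case=> f [fb fe] [g [gb ge]]; exists (g \o f); split; first exact: bij_comp.
by move=> x y; rewrite /= ge fe.
Qed.

Lemma isomorphic_source_sink H K : isomorphic H K ->
  has_source H = has_source K /\ has_sink H = has_sink K.
Proof.
case=> f [[g fK gK] fe].
have e : map f (enum H) =i enum K.
  move=> x; rewrite mem_enum inE; apply/mapP.
  by exists (g x); rewrite ?mem_enum ?gK.
have fI : injective f := can_inj fK.
by split; rewrite /has_source /has_sink -(eq_dominated _ e);
  apply/esym/dominated_map => [? ? _ _ /fI|? ? _ _] //; apply: fe.
Qed.

(** The arcs of [T4], [L4], [W4] and [C4] transported to [nat], where they can be evaluated by
    [vm_compute]. *)
Definition standard4_arc (source sink : bool) : rel nat :=
  fun i j => if source
    then if sink then i < j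
         else (i, j) \in [:: (0, 1); (1, 2); (2, 0); (3, 0); (3, 1); (3, 2)]
    else if sink
         then (i, j) \in [:: (0, 1); (1, 2); (2, 0); (0, 3); (1, 3); (2, 3)]
         else (i, j) \in [:: (0, 1); (1, 2); (2, 3); (3, 0); (0, 2); (1, 3)].

Definition standard4 (source sink : bool) : tournament :=
  if source then if sink then T4 else L4 else if sink then W4 else C4.

Definition rel_of_bits (b01 b02 b03 b12 b13 b23 : bool) : rel nat :=
  fun i j => nth false (nth [::]
    [:: [:: false; b01; b02; b03]; [:: ~~ b01; false; b12; b13];
        [:: ~~ b02; ~~ b12; false; b23]; [:: ~~ b03; ~~ b13; ~~ b23; false]]
    i) j.

(** A finite check: the six bits range over the 64 labelled tournaments on 0, 1, 2, 3, and for each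
    one the 24 relabellings [p] are searched. *)
Lemma rel_of_bits_standard4 b01 b02 b03 b12 b13 b23 :
  let e := rel_of_bits b01 b02 b03 b12 b13 b23 in
  let s := iota 0 4 in
  let std := standard4_arc (dominated e s) (dominated (fun i j => e j i) s) in
  has (fun p => all (fun i => all (fun j =>
      e (nth 0 p i) (nth 0 p j) == std i j) s) s)
    (permutations s).
Proof.
by case: b01; case: b02; case: b03; case: b12; case: b13; case: b23;
  vm_compute.
Qed.

Lemma isomorphic_standard4_seq (source sink : bool) (K : tournament)
    (f : nat -> K) :
  #|K| = 4 -> {in gtn 4 &, injective f} ->
  (forall i j, i < 4 -> j < 4 ->
     arc (f i) (f j) = standard4_arc source sink i j) ->
  isomorphic (standard4 source sink) K.
Proof.
move=> K4 fI fe.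
have fb : bijective (fun i : 'I_4 => f i).
  apply: inj_card_bij; last by rewrite K4 card_ord.
  by move=> i j /fI e; apply: val_inj; apply: e; apply: ltn_ord.
by case: source sink fe => [] [] fe; exists (fun i : 'I_4 => f i);
  split=> // i j; apply: fe.
Qed.

(** An enumeration [g] of [K] supplies the six bits; composing [g] with the relabelling [p] found by
    the finite check gives the isomorphism. *)
Lemma isomorphic_standard4 (K : tournament) :
  #|K| = 4 -> isomorphic (standard4 (has_source K) (has_sink K)) K.
Proof.
move=> K4.
have [x [y [z [w eK]]]] : exists x y z w : K, enum K = [:: x; y; z; w].
  have : size (enum K) = 4 by rewrite -cardE.
  case: (enum K) => [|x [|y [|z [|w [|]]]]] //= _.
  by exists x, y, z, w.
pose s := [:: x; y; z; w]; pose g := nth x s.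
pose e :=
  rel_of_bits (arc x y) (arc x z) (arc x w) (arc y z) (arc y w) (arc z w).
have us : uniq s by rewrite /s -eK enum_uniq.
have gI : {in gtn 4 &, injective g}.
  by move=> i j i4 j4 /eqP; rewrite nth_uniq // => /eqP.
have ge i j : i < 4 -> j < 4 -> arc (g i) (g j) = e i j.
  move: us; rewrite /= !inE !negb_or andbT => /and3P[].
  move=> /and3P[xy xz xw] /andP[yz yw] zw.
  by case: i j => [|[|[|[|//]]]] [|[|[|[|//]]]] _ _;
    rewrite /g /= ?arc_irr // arc_total // eq_sym.
have mI i : i \in iota 0 4 -> i < 4 by rewrite mem_iota.
have so : has_source K = dominated e (iota 0 4).
  rewrite /has_source eK -[[:: x; y; z; w]]/(map g (iota 0 4)).
  by apply: dominated_map => i j /mI i4 /mI j4; [apply: gI|apply: ge].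
have si : has_sink K = dominated (fun i j => e j i) (iota 0 4).
  rewrite /has_sink eK -[[:: x; y; z; w]]/(map g (iota 0 4)).
  by apply: dominated_map => i j /mI i4 /mI j4; [apply: gI|apply: ge].
have /hasP[p] := rel_of_bits_standard4 (arc x y) (arc x z) (arc x w) (arc y z)
  (arc y w) (arc z w).
rewrite -/e mem_permutations so si => pe /allP P.
have p4 i : i < 4 -> nth 0 p i < 4.
  move=> i4; apply: mI; rewrite -(perm_mem pe) mem_nth //.
  by rewrite (perm_size pe) size_iota.
apply: (@isomorphic_standard4_seq _ _ _ (g \o nth 0 p)) => //.
  move=> i j i4 j4 /gI; rewrite !inE => /(_ (p4 _ i4) (p4 _ j4)) /eqP.
  rewrite nth_uniq ?(perm_size pe) ?size_iota // => [/eqP //|].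
  by rewrite (perm_uniq pe) iota_uniq.
move=> i j i4 j4; rewrite /= ge ?p4 //.
have /allP Pi := P i (ltac:(by rewrite mem_iota)).
by apply/eqP/Pi; rewrite mem_iota.
Qed.

Lemma has_source_sink_standard4 source sink :
  has_source (standard4 source sink) = source /\
  has_sink (standard4 source sink) = sink.
Proof.
have ordE (e : rel 'I_4) (e' : rel nat) : (forall i j : 'I_4, e' i j = e i j) ->
    dominated e (enum 'I_4) = dominated e' (iota 0 4).
  move=> ee; rewrite -val_enum_ord; apply/esym/dominated_map => i j _ _.
    exact: val_inj.
  exact: ee.
pose e := standard4_arc source sink.
have -> : has_source (standard4 source sink) = dominated e (iota 0 4).
  by case: source sink @e => [] [] e; apply: ordE.
have -> : has_sink (standard4 source sink) =
    dominated (fun i j => e j i) (iota 0 4).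
  by case: source sink @e => [] [] e; apply: ordE.
by case: source sink @e => [] [] e.
Qed.

Lemma isomorphic4P (H K : tournament) : #|H| = 4 -> #|K| = 4 ->
  isomorphic H K <->
  has_source H = has_source K /\ has_sink H = has_sink K.
Proof.
move=> H4 K4; split=> [|[so si]]; first exact: isomorphic_source_sink.
apply: isomorphic_trans (isomorphic_standard4 K4).
by rewrite -so -si; apply/isomorphic_sym/isomorphic_standard4.
Qed.

(** * Densities as counts of 4-sets by source and sink *)

Definition count4 (T : tournament) (source sink : bool) : nat :=
  #|[set S : {set T} | (#|S| == 4) && ((dominated (@arc T) (enum S) == source)
      && (dominated (@coarc T) (enum S) == sink))]|.

Lemma has_source_sink_induced (T : tournament) (S : {set T}) :
  has_source (induced S) = dominated (@arc T) (enum S) /\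
  has_sink (induced S) = dominated (@coarc T) (enum S).
Proof.
have eS : map val (enum (induced S)) =i enum S.
  move=> x; rewrite mem_enum; apply/mapP/idP => [[y _ ->]|xS].
    exact: valP.
  by exists (exist _ x xS); rewrite ?mem_enum.
by split; rewrite -(eq_dominated _ eS); apply/esym/dominated_map => // x y _ _;
  apply: val_inj.
Qed.

Lemma card_induced (T : tournament) (S : {set T}) : #|induced S| = #|S|.
Proof. by rewrite card_sig; apply: eq_card. Qed.

Lemma density4E (R : realType) (H T : tournament) : #|H| = 4 ->
  density R H T =
    ((count4 T (has_source H) (has_sink H))%:R / 'C(#|T|, 4)%:R)%R.
Proof.
move=> H4; rewrite /density H4 /count4; congr (_%:R / _)%R.
apply: eq_card => S; rewrite !inE; case: eqP => //= S4.
have [<- <-] := has_source_sink_induced S.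
apply/asboolP/andP => [/isomorphic4P -/(_ H4)|[/eqP so /eqP si]].
  by rewrite card_induced => /(_ S4) [-> ->].
by apply/isomorphic4P; rewrite ?card_induced.
Qed.

(** * Sums over ordered quadruples of distinct vertices *)

Section Sum4.
Variable V : finType.
Implicit Types F : V -> V -> V -> V -> nat.

(** Distinctness is a 0/1 weight rather than a filter, so the four sums can be exchanged and
    factored one index at a time. *)
Definition sum4 F : nat :=
  \sum_x \sum_y \sum_z \sum_w uniq [:: x; y; z; w] * F x y z w.

Lemma eq_sum4 F G :
  (forall x y z w, uniq [:: x; y; z; w] -> F x y z w = G x y z w) ->
  sum4 F = sum4 G.
Proof.
move=> FG; do 4!apply: eq_bigr => ? _.
by case: (boolP (uniq _)) => // /FG ->.
Qed.

Lemma sum4_eq0 : sum4 (fun _ _ _ _ => 0) = 0.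
Proof. by do 4!rewrite ?/sum4 big1 // => *; rewrite muln0. Qed.

Lemma sum4D F G : sum4 (fun x y z w => F x y z w + G x y z w) = sum4 F + sum4 G.
Proof.
rewrite /sum4 -big_split; apply: eq_bigr => x _ /=.
rewrite -big_split; apply: eq_bigr => y _ /=.
rewrite -big_split; apply: eq_bigr => z _ /=.
by rewrite -big_split; apply: eq_bigr => w _ /=; rewrite mulnDr.
Qed.

Lemma sum4_swap12 F : sum4 (fun x y z w => F y x z w) = sum4 F.
Proof.
rewrite /sum4 exchange_big; do 4!apply: eq_bigr => ? _.
by congr (nat_of_bool _ * _); apply: perm_uniq; apply/permP => p /=; lia.
Qed.

Lemma sum4_swap23 F : sum4 (fun x y z w => F x z y w) = sum4 F.
Proof.
rewrite /sum4; apply: eq_bigr => x _; rewrite exchange_big.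
do 3!apply: eq_bigr => ? _.
by congr (nat_of_bool _ * _); apply: perm_uniq; apply/permP => p /=; lia.
Qed.

Lemma sum4_swap34 F : sum4 (fun x y z w => F x y w z) = sum4 F.
Proof.
rewrite /sum4; do 2!apply: eq_bigr => ? _; rewrite exchange_big.
do 2!apply: eq_bigr => ? _.
by congr (nat_of_bool _ * _); apply: perm_uniq; apply/permP => p /=; lia.
Qed.

(** Each 4-set is the set of entries of 4! = 24 duplicate-free tuples. *)
Lemma sum4_draws (F : {set V} -> nat) :
  sum4 (fun x y z w => F [set u in [:: x; y; z; w]]) =
  24 * \sum_(S : {set V} | #|S| == 4) F S.
Proof.
transitivity (\sum_(t : 4.-tuple V | uniq t) F [set u in t]).
  pose G x y z w := uniq [:: x; y; z; w] * F [set u in [:: x; y; z; w]].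
  transitivity (\sum_(p : V * (V * (V * V))) G p.1 p.2.1 p.2.2.1 p.2.2.2).
    rewrite -(pair_bigA _ (fun x q => G x q.1 q.2.1 q.2.2)) /=.
    apply: eq_bigr => x _; rewrite -(pair_bigA _ (fun y q => G x y q.1 q.2)) /=.
    by apply: eq_bigr => y _; rewrite -(pair_bigA _ (fun z w => G x y z w)).
  rewrite [RHS](reindex (fun p : V * (V * (V * V)) =>
    [tuple p.1; p.2.1; p.2.2.1; p.2.2.2])); last first.
    exists (fun t : 4.-tuple V => (tnth t ord0, (tnth t (inord 1),
      (tnth t (inord 2), tnth t (inord 3))))) => [[x [y [z w]]] _|t _] /=.
      by rewrite !(tnth_nth x) /= !inordK.
    case: t => [[|x [|y [|z [|w []]]]] //= ?]; apply: val_inj => /=.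
    by rewrite !(tnth_nth x) /= !inordK.
  rewrite [RHS]big_mkcond; apply: eq_bigr => p _; rewrite /G.
  rewrite -[tval _]/[:: p.1; p.2.1; p.2.2.1; p.2.2.2].
  by case: (uniq _); rewrite ?mul1n ?mul0n.
rewrite (partition_big (fun t : 4.-tuple V => [set u in t])
  (fun S : {set V} => #|S| == 4)) /=; last first.
  by move=> t ut; rewrite cardsE (card_uniqP ut) size_tuple.
rewrite big_distrr; apply: eq_bigr => S /eqP S4 /=.
rewrite (eq_bigr (fun=> F S)) => [|t /andP[_ /eqP -> //]].
rewrite sum_nat_const; congr (_ * _).
transitivity #|[set t : 4.-tuple V | all (mem S) t & uniq t]|; last first.
  by rewrite card_uniq_tuples S4.
apply: eq_card => t; rewrite !inE unfold_in /= andbC.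
case: (boolP (uniq t)) => ut; rewrite ?andbF ?andbT //.
apply/eqP/allP => [<- u|tS]; first by rewrite /= inE.
apply/eqP; rewrite eqEcard S4 cardsE (card_uniqP ut) size_tuple leqnn andbT.
by apply/fintype.subsetP => u; rewrite inE => /tS.
Qed.

End Sum4.

Section Sum4Symmetry.
Variables (V : finType) (F : V -> V -> V -> V -> nat).

Local Ltac s12 := refine (etrans (esym (sum4_swap12 _)) _).
Local Ltac s23 := refine (etrans (esym (sum4_swap23 _)) _).
Local Ltac s34 := refine (etrans (esym (sum4_swap34 _)) _).

(** The first argument of [F] runs over the four choices of a distinguished vertex; relabelling
    makes all summands equal. Such symmetrised forms reduce later identities to a check on each
    single quadruple. *)
Lemma sum4_choose1 :
  sum4 (fun x y z w => F x y z w + F y x z w + F z x y w + F w x y z) =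
  4 * sum4 F.
Proof.
have e2 : sum4 (fun x y z w => F y x z w) = sum4 F by exact: sum4_swap12.
have e3 : sum4 (fun x y z w => F z x y w) = sum4 F by s23.
have e4 : sum4 (fun x y z w => F w x y z) = sum4 F by s34.
by rewrite !sum4D e2 e3 e4; lia.
Qed.

(** The first two arguments run over the 12 ordered pairs, the candidates for a distinguished
    arc. *)
Lemma sum4_choose2 :
  sum4 (fun x y z w => F x y z w + F y x z w + F x z y w + F z x y w +
    F x w y z + F w x y z + F y z x w + F z y x w +
    F y w x z + F w y x z + F z w x y + F w z x y) = 12 * sum4 F.
Proof.
have yx : sum4 (fun x y z w => F y x z w) = sum4 F by exact: sum4_swap12.
have xz : sum4 (fun x y z w => F x z y w) = sum4 F by exact: sum4_swap23.
have zx : sum4 (fun x y z w => F z x y w) = sum4 F by s23.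
have xw : sum4 (fun x y z w => F x w y z) = sum4 F by s34.
have wx : sum4 (fun x y z w => F w x y z) = sum4 F by s34.
have yz : sum4 (fun x y z w => F y z x w) = sum4 F by s12.
have zy : sum4 (fun x y z w => F z y x w) = sum4 F by s12.
have yw : sum4 (fun x y z w => F y w x z) = sum4 F by s34.
have wy : sum4 (fun x y z w => F w y x z) = sum4 F by s34.
have zw : sum4 (fun x y z w => F z w x y) = sum4 F by s23.
have wz : sum4 (fun x y z w => F w z x y) = sum4 F by s34.
by rewrite !sum4D yx xz zx xw wx yz zy yw wy zw wz; lia.
Qed.

(** The first three arguments run over the four triples, each in its two cyclic orientations. *)
Lemma sum4_choose3 :
  sum4 (fun x y z w => F x y z w + F x z y w + F x y w z + F x w y z +
    F x z w y + F x w z y + F y z w x + F y w z x) = 8 * sum4 F.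
Proof.
have xzy : sum4 (fun x y z w => F x z y w) = sum4 F by exact: sum4_swap23.
have xyw : sum4 (fun x y z w => F x y w z) = sum4 F by exact: sum4_swap34.
have xwy : sum4 (fun x y z w => F x w y z) = sum4 F by s34.
have xzw : sum4 (fun x y z w => F x z w y) = sum4 F by s23.
have xwz : sum4 (fun x y z w => F x w z y) = sum4 F by s34.
have yzw : sum4 (fun x y z w => F y z w x) = sum4 F by s12.
have ywz : sum4 (fun x y z w => F y w z x) = sum4 F by s12.
by rewrite !sum4D xzy xyw xwy xzw xwz yzw ywz; lia.
Qed.

End Sum4Symmetry.

(** * Counting stars and cyclic triangles by degrees and codegrees *)

Section Counting.
Variable V : finType.
Implicit Types (A : pred V) (a : rel V).

Lemma sum_nat_pred A : \sum_x A x = #|A|.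
Proof.
rewrite -sum1_card [RHS]big_mkcond; apply: eq_bigr => x _.
by rewrite unfold_in; case: (A x).
Qed.

Lemma sum_pred_neq A x : A x -> \sum_z (A z && (z != x)) = #|A| - 1.
Proof.
move=> Ax; rewrite (sum_nat_pred (fun z => A z && (z != x))) (cardD1 x A).
rewrite [x \in A]Ax add1n subn1 /=.
by apply: eq_card => z; rewrite !inE andbC.
Qed.

Lemma sum_pred_neq2 A x y : A x -> A y -> x != y ->
  \sum_z (A z && (z != x) && (z != y)) = #|A| - 2.
Proof.
move=> Ax Ay xy; rewrite (sum_pred_neq (A := fun z => A z && (z != x))) //.
  by rewrite -sum_nat_pred sum_pred_neq // -subnDA.
by rewrite Ay eq_sym.
Qed.

Lemma sum_pred2 A :
  \sum_z \sum_w [&& z != w, A z & A w] = #|A| * (#|A| - 1).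
Proof.
rewrite -{1}sum_nat_pred big_distrl; apply: eq_bigr => z _ /=.
case Az: (A z); last by rewrite mul0n big1 // => w _; rewrite andbF.
rewrite mul1n -(sum_pred_neq Az); apply: eq_bigr => w _.
by rewrite andbC eq_sym.
Qed.

Lemma sum_pred3 A :
  \sum_y \sum_z \sum_w [&& uniq [:: y; z; w], A y, A z & A w] =
  #|A| * (#|A| - 1) * (#|A| - 2).
Proof.
rewrite -sum_pred2 big_distrl; apply: eq_bigr => y _ /=.
rewrite big_distrl; apply: eq_bigr => z _ /=.
have [<-|yz] /= := eqVneq y z.
  by rewrite mul0n big1 // => w _; rewrite !inE eqxx.
case Ay: (A y); last by rewrite mul0n big1 // => w _; rewrite andbF.
case Az: (A z); last by rewrite mul0n big1 // => w _; rewrite !andbF.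
rewrite mul1n -(sum_pred_neq2 Ay Az yz); apply: eq_bigr => w _.
rewrite !inE negb_or yz (eq_sym w y) (eq_sym w z) !andbT /=.
by rewrite andbC andbA.
Qed.

Lemma sum4_out_star a : irreflexive a ->
  sum4 (fun x y z w => [&& a x y, a x z & a x w]) =
  \sum_x #|a x| * (#|a x| - 1) * (#|a x| - 2).
Proof.
move=> irr; apply: eq_bigr => x _; rewrite -sum_pred3.
apply: eq_bigr => y _; apply: eq_bigr => z _; apply: eq_bigr => w _.
have neq u : a x u -> x != u by apply: contraTneq => <-; rewrite irr.
rewrite mulnb cons_uniq !inE !negb_or; congr nat_of_bool.
case xy: (a x y); last by rewrite !andbF.
case xz: (a x z); last by rewrite !andbF.
case xw: (a x w); last by rewrite !andbF.
by rewrite (neq _ xy) (neq _ xz) (neq _ xw).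
Qed.

(** When [a x y] holds, this is the number of cyclic triangles through that arc. *)
Definition codeg a (x y : V) : nat := #|[pred z | a y z && a z x]|.

Lemma sum4_edge_pair a : irreflexive a ->
  sum4 (fun x y z w => [&& a x y, a y z, a z x, a y w & a w x]) =
  \sum_x \sum_y a x y * (codeg a x y * (codeg a x y - 1)).
Proof.
move=> irr; apply: eq_bigr => x _; apply: eq_bigr => y _.
rewrite /codeg -(sum_pred2 (fun z => a y z && a z x)) big_distrr.
apply: eq_bigr => z _ /=; rewrite big_distrr; apply: eq_bigr => w _ /=.
have neq u v : a u v -> u != v by apply: contraTneq => <-; rewrite irr.
rewrite !mulnb !inE !negb_or andbT; congr nat_of_bool.
case xy: (a x y); last by rewrite !andbF.
case yz: (a y z); last by rewrite !andbF.
case zx: (a z x); last by rewrite !andbF.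
case yw: (a y w); last by rewrite !andbF.
case wx: (a w x); last by rewrite !andbF.
rewrite (neq _ _ xy) (neq _ _ yz) (neq _ _ yw) /=.
by rewrite (eq_sym x z) (eq_sym x w) (neq _ _ zx) (neq _ _ wx) andbT.
Qed.

(** The fourth vertex is unconstrained apart from distinctness, hence the factor [#|V| - 3]. *)
Lemma sum4_cyclic a : irreflexive a ->
  sum4 (fun x y z w => [&& a x y, a y z & a z x]) =
  (#|V| - 3) * \sum_x \sum_y a x y * codeg a x y.
Proof.
move=> irr; rewrite big_distrr; apply: eq_bigr => x _ /=.
rewrite big_distrr; apply: eq_bigr => y _ /=.
rewrite /codeg -(sum_nat_pred (fun z => a y z && a z x)) !big_distrr.
apply: eq_bigr => z _ /=; rewrite mulnb.
case t: [&& a x y, a y z & a z x]; last first.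
  by rewrite muln0 big1 // => w _; rewrite muln0.
move/and3P: t => [axy ayz azx]; rewrite muln1.
have us : uniq [:: x; y; z].
  rewrite /= !inE negb_or andbT; apply/andP; split; first apply/andP; try split.
  - by apply: contraTneq axy => ->; rewrite irr.
  - by apply: contraTneq azx => ->; rewrite irr.
  - by apply: contraTneq ayz => ->; rewrite irr.
rewrite -(cardC (mem [:: x; y; z])) (card_uniqP us) addKn.
rewrite -(sum_nat_pred [predC [:: x; y; z]]); apply: eq_bigr => w _.
transitivity (nat_of_bool (uniq (rcons [:: x; y; z] w))).
  by rewrite muln1.
by rewrite rcons_uniq us andbT.
Qed.

End Counting.

(** * Counting identities in a tournament *)

Lemma dominated4 (V : eqType) (e : rel V) x y z w : uniq [:: x; y; z; w] ->
  dominated e [:: x; y; z; w] =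
  [|| [&& e x y, e x z & e x w], [&& e y x, e y z & e y w],
      [&& e z x, e z y & e z w] | [&& e w x, e w y & e w z]].
Proof.
rewrite /= !inE !negb_or !andbT => /and3P[/and3P[xy xz xw] /andP[yz yw] zw].
rewrite /dominated /= !eqxx (eq_sym y x) (eq_sym z x) (eq_sym w x).
rewrite (eq_sym z y) (eq_sym w y) (eq_sym w z) (negPf xy) (negPf xz).
by rewrite (negPf xw) (negPf yz) (negPf yw) (negPf zw) /= !andbT orbF.
Qed.

Section Identities.
Variable T : tournament.
Implicit Types x y z w : T.

Lemma coarc_irr : irreflexive (@coarc T).
Proof. by move=> x; apply: arc_irr. Qed.

Lemma arcs4 x y z w : uniq [:: x; y; z; w] ->
  ((arc y x = ~~ arc x y) * (arc z x = ~~ arc x z) *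
   (arc w x = ~~ arc x w) * (arc z y = ~~ arc y z) *
   (arc w y = ~~ arc y w) * (arc w z = ~~ arc z w))%type.
Proof.
rewrite /= !inE !negb_or !andbT => /and3P[/and3P[xy xz xw] /andP[yz yw] zw].
by do !split; apply: arc_total; rewrite eq_sym.
Qed.

Lemma count4E source sink :
  count4 T source sink = \sum_(S : {set T} | #|S| == 4)
    ((dominated (@arc T) (enum S) == source) &&
     (dominated (@coarc T) (enum S) == sink)).
Proof.
rewrite /count4 -sum1dep_card big_mkcondr; apply: eq_bigr => S _.
by case: (_ && _).
Qed.

Lemma count4_sum4 source sink :
  24 * count4 T source sink = sum4 (fun x y z w =>
    (dominated (@arc T) [:: x; y; z; w] == source) &&
    (dominated (@coarc T) [:: x; y; z; w] == sink)).
Proof.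
rewrite count4E -sum4_draws; apply: eq_sum4 => x y z w _.
have e : enum [set u in [:: x; y; z; w]] =i [:: x; y; z; w].
  by move=> u; rewrite mem_enum !inE.
by rewrite !(eq_dominated _ e).
Qed.

Lemma count4_total :
  count4 T true true + count4 T true false + count4 T false true +
  count4 T false false = 'C(#|T|, 4).
Proof.
rewrite !count4E -!big_split -card_draws -sum1dep_card /=.
apply: eq_bigr => S _.
by do 2!case: (dominated _ _).
Qed.

(** A 4-set has at most one source, so the four star indicators add up to the indicator of having
    one. This is checked on all 64 orientations of a quadruple. *)
Lemma count4_source :
  24 * (count4 T true true + count4 T true false) =
  4 * \sum_(x : T) #|arc x| * (#|arc x| - 1) * (#|arc x| - 2).
Proof.
rewrite -(sum4_out_star (@arc_irr T)) -sum4_choose1 mulnDr !count4_sum4 -sum4D.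
apply: eq_sum4 => x y z w u; rewrite !dominated4 // /coarc !(arcs4 u).
by case: (arc x y); case: (arc x z); case: (arc x w);
  case: (arc y z); case: (arc y w); case: (arc z w).
Qed.

Lemma count4_sink :
  24 * (count4 T true true + count4 T false true) =
  4 * \sum_(x : T) #|coarc x| * (#|coarc x| - 1) * (#|coarc x| - 2).
Proof.
rewrite -(sum4_out_star coarc_irr) -sum4_choose1 mulnDr !count4_sum4 -sum4D.
apply: eq_sum4 => x y z w u; rewrite !dominated4 // /coarc !(arcs4 u).
by case: (arc x y); case: (arc x z); case: (arc x w);
  case: (arc y z); case: (arc y w); case: (arc z w).
Qed.

(* In a strongly connected 4-vertex tournament exactly one arc lies on two
   cyclic triangles, and no other 4-vertex tournament has such an arc. *)
Lemma count4_strong :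
  24 * count4 T false false =
  12 * \sum_(x : T) \sum_(y : T)
    arc x y * (codeg (@arc T) x y * (codeg (@arc T) x y - 1)).
Proof.
rewrite -(sum4_edge_pair (@arc_irr T)) -sum4_choose2 !count4_sum4.
apply: eq_sum4 => x y z w u; rewrite !dominated4 // /coarc !(arcs4 u).
by case: (arc x y); case: (arc x z); case: (arc x w);
  case: (arc y z); case: (arc y w); case: (arc z w).
Qed.

(** [C4] contains two cyclic triangles, [L4] and [W4] one each, [T4] none. *)
Lemma count4_cyclic :
  24 * (2 * count4 T false false + count4 T true false + count4 T false true) =
  8 * ((#|T| - 3) * \sum_(x : T) \sum_(y : T) arc x y * codeg (@arc T) x y).
Proof.
rewrite -(sum4_cyclic (@arc_irr T)) -sum4_choose3.
rewrite mul2n -addnn !mulnDr !count4_sum4 -!sum4D.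
apply: eq_sum4 => x y z w u; rewrite !dominated4 // /coarc !(arcs4 u).
by case: (arc x y); case: (arc x z); case: (arc x w);
  case: (arc y z); case: (arc y w); case: (arc z w).
Qed.

Lemma sum_arc : 2 * (\sum_(x : T) \sum_(y : T) arc x y) = #|T| * (#|T| - 1).
Proof.
rewrite mul2n -addnn {2}exchange_big -big_split /= -sum_nat_const.
apply: eq_bigr => x _; rewrite -big_split /=.
rewrite -(sum_pred_neq (A := predT) (x := x)) //.
apply: eq_bigr => y _ /=; have [->|xy] := eqVneq y x; first by rewrite arc_irr.
by rewrite (arc_total xy); case: (arc x y).
Qed.

Lemma sum_outdegree : 2 * (\sum_(x : T) #|arc x|) = #|T| * (#|T| - 1).
Proof.
rewrite -sum_arc; congr (2 * _); apply: eq_bigr => x _.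
by rewrite -sum_nat_pred.
Qed.

Lemma sum_indegree : 2 * (\sum_(x : T) #|coarc x|) = #|T| * (#|T| - 1).
Proof.
rewrite -sum_arc exchange_big; congr (2 * _); apply: eq_bigr => x _.
by rewrite -sum_nat_pred.
Qed.

End Identities.

Local Open Scope ring_scope.

(** * Convexity bounds for the densities of one tournament *)

Lemma binomial4E (F : numFieldType) n : (4 <= n)%N ->
  'C(n, 4)%:R = n%:R * (n%:R - 1) * (n%:R - 2) * (n%:R - 3) / 24 :> F.
Proof.
move=> n4; have /(congr1 (fun m => m%:R : F)) := bin_ffact n 4.
have -> : 4`! = 24%N by [].
rewrite natrM !ffactnS ffactn0 muln1 !natrM -!subn1 !natrB; try by lia.
have nz : 24 != 0 :> F by rewrite pnatr_eq0.
by move=> e; apply: (mulIf nz); rewrite e divfK //; ring.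
Qed.

(** Truncated subtraction is harmless: it differs from true subtraction only for [d < 2], where
    another factor vanishes on both sides. *)
Lemma natr_falling3 (F : realDomainType) d :
  (d * (d - 1) * (d - 2))%:R = d%:R * (d%:R - 1) * (d%:R - 2) :> F.
Proof.
case: d => [|[|d]]; rewrite ?mul0r ?subrr ?mulr0 ?mul0r //.
by rewrite !natrM !natrB.
Qed.

Lemma natr_falling2 (F : realDomainType) d :
  (d * (d - 1))%:R = d%:R * (d%:R - 1) :> F.
Proof. by case: d => [|d]; rewrite ?mul0n ?mul0r // natrM natrB. Qed.

(* Tangent line of [d * (d - 1) * (d - 2)] at the mean [(n - 1) / 2]. *)
Lemma sum_falling3_ge (F : realFieldType) (V : finType) (d : V -> nat) :
  (4 <= #|V|)%N -> (2 * \sum_x d x = #|V| * (#|V| - 1))%N ->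
  #|V|%:R * (#|V|%:R - 1) * (#|V|%:R - 3) * (#|V|%:R - 5) / 8 <=
  (\sum_x d x * (d x - 1) * (d x - 2))%N%:R :> F.
Proof.
set n := #|V| => n4 /(congr1 (fun m => m%:R : F)).
rewrite natr_falling2 natrM !natr_sum => sd.
have n4' : 4 <= n%:R :> F by rewrite ler_nat.
pose a : F := (n%:R - 1) / 2; pose b : F := 3 * a ^+ 2 - 6 * a + 2.
have tangent x : a * (a - 1) * (a - 2) + b * ((d x)%:R - a) <=
    (d x * (d x - 1) * (d x - 2))%:R :> F.
  rewrite natr_falling3 -subr_ge0.
  (* [b] is the derivative at [a], so the difference has a double root there; the remaining factor
     is nonnegative because [n >= 4] gives [2 * a >= 3]. *)
  have -> : (d x)%:R * ((d x)%:R - 1) * ((d x)%:R - 2) -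
    (a * (a - 1) * (a - 2) + b * ((d x)%:R - a)) =
    ((d x)%:R - a) ^+ 2 * ((d x)%:R + 2 * a - 3) :> F by rewrite /b; ring.
  apply: mulr_ge0; first exact: sqr_ge0.
  by have : 0 <= (d x)%:R :> F by []; rewrite /a; lra.
apply: le_trans (ler_sum _ (fun x _ => tangent x)).
have cst (c : F) : \sum_(x : V) c = n%:R * c by rewrite sumr_const mulr_natl.
rewrite big_split /= cst -mulr_sumr sumrB cst.
have -> : \sum_i (d i)%:R = n%:R * a :> F by rewrite /a; lra.
by rewrite subrr mulr0 addr0 /a; lra.
Qed.

Section Densities.
Variables (R : realType) (T : tournament).
Hypothesis T4le : (4 <= #|T|)%N.

Local Notation n := (#|T|%:R : R).
Local Notation t := (t4 R T).
Local Notation c := (c4 R T).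
Local Notation w := (w4 R T).
Local Notation l := (l4 R T).
Local Notation D := ('C(#|T|, 4)%:R : R).

Lemma density_standard4 source sink :
  density R (standard4 source sink) T = (count4 T source sink)%:R / D.
Proof.
rewrite density4E; last by case: source sink => [] []; apply: card_ord.
by have [-> ->] := has_source_sink_standard4 source sink.
Qed.

Let n4 : 4 <= n. Proof. by rewrite ler_nat. Qed.

Let DE : D = n * (n - 1) * (n - 2) * (n - 3) / 24.
Proof. exact: binomial4E. Qed.

Let D_gt0 : 0 < D. Proof. by rewrite ltr0n bin_gt0. Qed.

Let tE : t * D = (count4 T true true)%:R.
Proof. by rewrite /t4 (density_standard4 true true) divfK // gt_eqF. Qed.

Let lE : l * D = (count4 T true false)%:R.
Proof. by rewrite /l4 (density_standard4 true false) divfK // gt_eqF. Qed.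

Let wE : w * D = (count4 T false true)%:R.
Proof. by rewrite /w4 (density_standard4 false true) divfK // gt_eqF. Qed.

Let cE : c * D = (count4 T false false)%:R.
Proof. by rewrite /c4 (density_standard4 false false) divfK // gt_eqF. Qed.

Lemma density4_total : t + l + w + c = 1.
Proof.
apply: (mulIf (lt0r_neq0 D_gt0)); rewrite !mulrDl tE lE wE cE mul1r.
by rewrite -!natrD count4_total.
Qed.

(** Here [p] is [t + l] for outdegrees and [t + w] for indegrees. Convexity gives (n - 5) / (2 (n -
    2)), which is weakened to share the error term 3 / (n - 3) with [strong_density_ge]. *)
Lemma star_density_ge (p : R) (d : T -> nat) :
  (2 * \sum_x d x = #|T| * (#|T| - 1))%N ->
  24 * (p * D) = 4 * (\sum_x d x * (d x - 1) * (d x - 2))%N%:R ->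
  1 / 2 - 3 / (n - 3) <= p.
Proof.
move=> /(sum_falling3_ge R T4le) S pE.
have n2 : 0 < n - 2 by have := n4; lra.
have n3 : 0 < n - 3 by have := n4; lra.
have n2z := lt0r_neq0 n2; have n3z := lt0r_neq0 n3.
apply: (@le_trans _ _ ((n - 5) / (2 * (n - 2)))).
  have -> : (n - 5) / (2 * (n - 2)) = 1 / 2 - 3 / 2 / (n - 2).
    by field.
  rewrite lerD2l lerN2 ler_pdivrMr //.
  have -> : 3 / (n - 3) * (n - 2) = 3 + 3 / (n - 3) by field.
  have : 0 <= 3 / (n - 3) by rewrite divr_ge0 // ltW.
  by lra.
rewrite -(ler_pM2r D_gt0).
have -> : (n - 5) / (2 * (n - 2)) * D = n * (n - 1) * (n - 3) * (n - 5) / 48.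
  by rewrite DE; field.
lra.
Qed.

Lemma source_density_ge : 1 / 2 - 3 / (n - 3) <= t + l.
Proof.
apply: (star_density_ge (sum_outdegree T)).
by rewrite [(t + l) * _]mulrDl tE lE -natrD -!natrM count4_source.
Qed.

Lemma sink_density_ge : 1 / 2 - 3 / (n - 3) <= t + w.
Proof.
apply: (star_density_ge (sum_indegree T)).
by rewrite [(t + w) * _]mulrDl tE wE -natrD -!natrM count4_sink.
Qed.

(** Expanding (k - a)^2 >= 0 gives k (k - 1) >= (2 a - 1) k - a^2; this is summed over the n (n - 1)
    / 2 arcs. *)
Lemma codeg_quadratic_ge (a : R) :
  (2 * a - 1) * (\sum_(x : T) \sum_(y : T) arc x y * codeg (@arc T) x y)%N%:R -
    a ^+ 2 * (n * (n - 1) / 2) <=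
  (\sum_(x : T) \sum_(y : T)
     arc x y * (codeg (@arc T) x y * (codeg (@arc T) x y - 1)))%N%:R.
Proof.
have -> : n * (n - 1) / 2 = (\sum_(x : T) \sum_(y : T) arc x y)%N%:R.
  have /(congr1 (fun m => m%:R : R)) := sum_arc T.
  by rewrite natr_falling2 natrM => <-; field.
rewrite !natr_sum !mulr_sumr -sumrB; apply: ler_sum => x _.
rewrite !natr_sum !mulr_sumr -sumrB; apply: ler_sum => y _.
rewrite !natrM; case: (arc x y); rewrite ?mul0r ?mulr0 ?subr0 // !mul1r.
rewrite -natrM natr_falling2; set k := (codeg _ x y)%:R.
rewrite -[nat_of_bool true]/1%N mulr1.
by rewrite -subr_ge0; have := sqr_ge0 (k - a); lra.
Qed.

Lemma strong_density_ge : 3 / 8 * (1 + c - t) ^+ 2 - 3 / (n - 3) <= c.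
Proof.
have s_le2 : 1 + c - t <= 2.
  have /andP[_ c1] : 0 <= c <= 1 := density_ge0_le1 R C4 T.
  by have /andP[t0 _] : 0 <= t <= 1 := density_ge0_le1 R T4 T; lra.
have s_ge0 : 0 <= 1 + c - t.
  have /andP[c0 _] : 0 <= c <= 1 := density_ge0_le1 R C4 T.
  by have /andP[_ t1] : 0 <= t <= 1 := density_ge0_le1 R T4 T; lra.
have sE : 1 + c - t = 2 * c + l + w by have := density4_total; lra.
set s := 1 + c - t in s_le2 s_ge0 sE *.
(* The best choice of [a] is the mean codegree over all arcs, which [XE] below shows to be s (n - 2)
   / 4. *)
have := codeg_quadratic_ge (s * (n - 2) / 4).
have := count4_cyclic T; have := count4_strong T.
set X := (\sum_x \sum_y _ * codeg _ x y)%N.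
set Y := (\sum_x \sum_y _ * _)%N.
move=> /(congr1 (fun m => m%:R : R)); rewrite !natrM -cE => cY.
move=> /(congr1 (fun m => m%:R : R)).
rewrite !natrM natrD natrD natrM -cE -lE -wE => sX.
have n2 : 0 < n - 2 by have := n4; lra.
have n3 : 0 < n - 3 by have := n4; lra.
have n2z := lt0r_neq0 n2; have n3z := lt0r_neq0 n3.
have XE : X%:R = s * n * (n - 1) * (n - 2) / 8.
  apply: (mulfI (lt0r_neq0 n3)); rewrite natrB in sX; last by lia.
  have {}sX : 24 * (s * D) = 8 * ((n - 3) * X%:R) by rewrite -sX sE; ring.
  by rewrite DE in sX; lra.
rewrite XE => quad; rewrite -(ler_pM2r D_gt0).
have {}cY : c * D = Y%:R / 2 by lra.
rewrite cY.
apply: le_trans (ler_wpM2r _ quad); last by rewrite invr_ge0.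
have -> : (3 / 8 * s ^+ 2 - 3 / (n - 3)) * D =
   n * (n - 1) * (n - 2) * (s ^+ 2 * (n - 3) / 64 - 1 / 8).
  by rewrite DE; field.
have -> : ((2 * (s * (n - 2) / 4) - 1) * (s * n * (n - 1) * (n - 2) / 8) -
   (s * (n - 2) / 4) ^+ 2 * (n * (n - 1) / 2)) / 2 =
   n * (n - 1) * (n - 2) * (s ^+ 2 * (n - 2) / 64 - s / 16) by field.
apply: ler_wpM2l; first by rewrite !mulr_ge0 //; lra.
(* What remains is s^2 / 64 + (2 - s) / 16 >= 0. *)
by have := sqr_ge0 s; lra.
Qed.

End Densities.

(** * Circular tournaments *)

Section CircularTournament.
Variable m : nat.
Implicit Types i j : 'I_m.

(** Turns adjacency into linear inequalities between labels, within reach of [lia]. *)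
Lemma circular_arcE i j : circular_arc i j =
  (i < j)%N && (2 * (j - i) < m)%N || (j < i)%N && (m < 2 * (i - j))%N.
Proof.
by rewrite /circular_arc !clockwiseE; have := ltn_ord i; have := ltn_ord j;
  case: (ltngtP i j); lia.
Qed.

(** The out-neighbours of [i] have distinct clockwise distances from [i], all between 1 and
    [m./2]. *)
Lemma circular_outdegree_le i : (#|circular_arc i| <= m./2)%N.
Proof.
rewrite cardE -(size_map (fun j => clockwise i j)) -(size_iota 1 m./2).
apply: uniq_leq_size.
  rewrite map_inj_uniq ?enum_uniq // => j j'.
  rewrite !clockwiseE; have := ltn_ord i; have := ltn_ord j; have := ltn_ord j'.
  move=> ? ? ? e; apply: val_inj; move: e => /=.
  by case: (leqP i j); case: (leqP i j'); lia.
move=> x /mapP[j ij ->].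
have {ij} : circular_arc i j by move: ij; rewrite mem_enum.
rewrite circular_arcE mem_iota clockwiseE; have := ltn_ord i; have := ltn_ord j.
by case: (leqP i j); lia.
Qed.

(** Out-neighbours of [i] lie on the open half circle following [i], where every arc goes
    clockwise. *)
Lemma circular_out_acyclic i j k h : ~~ [&& circular_arc i j, circular_arc i k,
  circular_arc i h, circular_arc j k, circular_arc k h & circular_arc h j].
Proof.
apply/negP; rewrite !circular_arcE.
have := ltn_ord i; have := ltn_ord j; have := ltn_ord k; have := ltn_ord h.
lia.
Qed.

Lemma circular_in_acyclic i j k h : ~~ [&& circular_arc j i, circular_arc k i,
  circular_arc h i, circular_arc j k, circular_arc k h & circular_arc h j].
Proof.
apply/negP; rewrite !circular_arcE.
have := ltn_ord i; have := ltn_ord j; have := ltn_ord k; have := ltn_ord h.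
lia.
Qed.

End CircularTournament.

(** In a 4-set with a source and no sink, the other three vertices form a cyclic triangle. *)
Lemma count4_source_eq0 (T : tournament) :
  (forall v x y z : T, ~~ [&& arc v x, arc v y, arc v z,
     arc x y, arc y z & arc z x]) -> count4 T true false = 0%N.
Proof.
move=> acyclic; suff: (24 * count4 T true false = 0)%N by lia.
rewrite count4_sum4 (@eq_sum4 _ _ (fun _ _ _ _ => 0%N)).
  exact: sum4_eq0.
move=> x y z w u; rewrite !dominated4 // /coarc.
(* Four candidates for the source, and two directions for the triangle on the others. *)
move: (acyclic x y z w) (acyclic x y w z) (acyclic y x z w) (acyclic y x w z)
  (acyclic z x y w) (acyclic z x w y) (acyclic w x y z) (acyclic w x z y).
rewrite !(arcs4 u).
by case: (arc x y); case: (arc x z); case: (arc x w);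
  case: (arc y z); case: (arc y w); case: (arc z w).
Qed.

Lemma count4_sink_eq0 (T : tournament) :
  (forall v x y z : T, ~~ [&& arc x v, arc y v, arc z v,
     arc x y, arc y z & arc z x]) -> count4 T false true = 0%N.
Proof.
move=> acyclic; suff: (24 * count4 T false true = 0)%N by lia.
rewrite count4_sum4 (@eq_sum4 _ _ (fun _ _ _ _ => 0%N)).
  exact: sum4_eq0.
move=> x y z w u; rewrite !dominated4 // /coarc.
move: (acyclic x y z w) (acyclic x y w z) (acyclic y x z w) (acyclic y x w z)
  (acyclic z x y w) (acyclic z x w y) (acyclic w x y z) (acyclic w x z y).
rewrite !(arcs4 u).
by case: (arc x y); case: (arc x z); case: (arc x w);
  case: (arc y z); case: (arc y w); case: (arc z w).
Qed.

Section CircularDensities.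
Variables (R : realType) (k : nat).

Lemma card_circular_seq : #|circular_seq k| = k.*2.+1.
Proof. by rewrite card_ord. Qed.

Lemma l4_circular : l4 R (circular_seq k) = 0.
Proof.
rewrite /l4 (density_standard4 R _ true false) count4_source_eq0 ?mul0r //.
by move=> v x y z; exact: (@circular_out_acyclic k.*2.+1 v x y z).
Qed.

Lemma w4_circular : w4 R (circular_seq k) = 0.
Proof.
rewrite /w4 (density_standard4 R _ false true) count4_sink_eq0 ?mul0r //.
by move=> v x y z; exact: (@circular_in_acyclic k.*2.+1 v x y z).
Qed.

(** As no 4-set is a copy of [L4], the star count gives [t4] alone, and each outdegree is at most
    [k]. *)
Lemma t4_circular_le : (2 <= k)%N -> t4 R (circular_seq k) <= 1 / 2.
Proof.
move=> k2; rewrite /t4 (density_standard4 R _ true true).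
have out (x : circular_seq k) : (#|arc x| <= k)%N.
  have := circular_outdegree_le (m := k.*2.+1) x.
  by rewrite /= uphalf_double.
have := count4_source (circular_seq k).
rewrite count4_source_eq0 ?addn0; last first.
  by move=> v x y z; exact: (@circular_out_acyclic k.*2.+1 v x y z).
have S : (\sum_(x : circular_seq k)
      #|arc x| * (#|arc x| - 1) * (#|arc x| - 2) <=
    k.*2.+1 * (k * (k - 1) * (k - 2)))%N.
  rewrite -card_circular_seq -sum_nat_const; apply: leq_sum => x _.
  by rewrite !leq_mul ?leq_sub2r.
move=> e; have {S e} : (24 * count4 (circular_seq k) true true <=
  4 * (k.*2.+1 * (k * (k - 1) * (k - 2))))%N by rewrite e leq_mul2l S.
rewrite -(ler_nat R) [(24 * _)%N%:R]natrM [(4 * _)%N%:R]natrM.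
rewrite [(_.+1 * _)%N%:R]natrM natr_falling3 => le.
have k2' : 2 <= k%:R :> R by rewrite ler_nat.
have nE : (k.*2.+1)%:R = 2 * k%:R + 1 :> R by rewrite -addn1 natrD -mul2n natrM.
rewrite card_circular_seq ler_pdivrMr ?ltr0n ?bin_gt0; last by lia.
rewrite binomial4E; last by lia.
rewrite nE in le *; set K : R := k%:R in k2' le *.
(* Up to constants this is a common factor of both sides; without it the claim is (K - 2) / (2 K -
   1) <= 1 / 2. *)
have pos : 0 <= (2 * K + 1) * (K * (K - 1)) by rewrite !mulr_ge0 //; lra.
nra.
Qed.

End CircularDensities.

Local Open Scope classical_set_scope.
Local Open Scope ring_scope.

(** * From upper and lower limits to eventual bounds and back *)

Section LimitBounds.
Variables (R : realType) (u : nat -> R).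
Hypothesis u01 : forall n, 0 <= u n <= 1.

Let u_ub : has_ubound (range u).
Proof. by exists 1 => _ [n _ <-]; have /andP[] := u01 n. Qed.

Let u_lb : has_lbound (range u).
Proof. by exists 0 => _ [n _ <-]; have /andP[] := u01 n. Qed.

Lemma limn_sup_lt_near a : limn_sup u < a -> \forall n \near \oo, u n < a.
Proof.
move=> ua; have cu : cvgn (sups u) by apply: cvgP (cvg_sups_inf u_ub u_lb).
near=> n; apply: (@le_lt_trans _ _ (sups u n)).
  by apply: ub_le_sup; [exact: has_ubound_sdrop|exists n => /=].
by near: n; apply: (cvgr_lt _ cu).
Unshelve. all: by end_near. Qed.

Lemma limn_inf_ge_near a : (\forall n \near \oo, a <= u n) -> a <= limn_inf u.
Proof.
move=> [N _ uN]; apply: limr_ge; first exact: cvgP (cvg_infs_sup u_ub u_lb).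
near=> n; apply: lb_le_inf; first by exists (u n), n => /=.
move=> _ [m /= nm <-]; apply: uN => /=; apply: leq_trans nm.
by near: n; apply: nbhs_infty_ge.
Unshelve. all: by end_near. Qed.

End LimitBounds.

(** * Asymptotic inequalities between the four densities *)

Section Asymptotics.
Variables (R : realType) (T : nat -> tournament).
Hypothesis Too : #|T n| @[n --> \oo] --> \oo.

Local Notation t n := (t4 R (T n)).
Local Notation c n := (c4 R (T n)).
Local Notation w n := (w4 R (T n)).
Local Notation l n := (l4 R (T n)).

Lemma density4_near (d : R) : 0 < d -> \forall n \near \oo,
  [/\ 1 / 2 - d <= t n + l n, 1 / 2 - d <= t n + w n,
      3 / 8 * (1 + c n - t n) ^+ 2 - d <= c n & t n + l n + w n + c n = 1].
Proof.
(* This threshold gives [#|T n| - 3 > 3 / d], so the error 3 / (n - 3) is at most [d]. *)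
move=> d0; have : \forall n \near \oo, (4 + Num.bound (3 / d) <= #|T n|)%N.
  exact: Too (nbhs_infty_ge _).
apply: filterS => n /= cardT.
have T4le : (4 <= #|T n|)%N by apply: leq_trans cardT; rewrite leq_addr.
have err : 3 / (#|T n|%:R - 3) <= d.
  have : 3 / d < (Num.bound (3 / d))%:R.
    by rewrite archi_boundP // divr_ge0 // ltW.
  move: cardT; rewrite -(ler_nat R) natrD => cardT bd.
  have n3 : 0 < #|T n|%:R - 3 :> R.
    have : 0 <= (Num.bound (3 / d))%:R :> R by [].
    by lra.
  rewrite ler_pdivrMr // mulrC -ler_pdivrMr //.
  by lra.
have so := source_density_ge R T4le; have si := sink_density_ge R T4le.
have st := strong_density_ge R T4le; have to := density4_total R T4le.
by split=> //; lra.
Qed.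

Lemma t4_near_lt (d : R) : 0 < d ->
  \forall n \near \oo, t n < limn_sup (fun n => t n) + d.
Proof.
move=> d0; apply: limn_sup_lt_near => [n|]; first exact: density_ge0_le1.
by rewrite ltrDl.
Qed.

(** The slack [d] is split evenly between the source inequality and the eventual bound on [t4]. *)
Lemma l4_limn_inf_ge :
  1 / 2 - limn_sup (fun n => t n) <= limn_inf (fun n => l n).
Proof.
apply/ler_addgt0Pr => d d0; rewrite -lerBlDr.
apply: limn_inf_ge_near; first by move=> n; apply: density_ge0_le1.
have d2 : 0 < d / 2 by lra.
have := t4_near_lt d2.
have := density4_near d2.
by apply: filterS2 => n [so _ _ _] tn; lra.
Qed.

Lemma w4_limn_inf_ge :
  1 / 2 - limn_sup (fun n => t n) <= limn_inf (fun n => w n).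
Proof.
apply/ler_addgt0Pr => d d0; rewrite -lerBlDr.
apply: limn_inf_ge_near; first by move=> n; apply: density_ge0_le1.
have d2 : 0 < d / 2 by lra.
have := t4_near_lt d2.
have := density4_near d2.
by apply: filterS2 => n [_ si _ _] tn; lra.
Qed.

Hypothesis t_le : limn_sup (fun n => t n) <= 1 / 2.

(* [3 / 8 * (1 / 2 + c) ^+ 2 <= c] means [(c - 1 / 6) * (c - 3 / 2) <= 0]. *)
Lemma c4_near_ge (d : R) : 0 < d <= 1 / 2 ->
  \forall n \near \oo, 1 / 6 - 6 * d <= c n.
Proof.
move=> /andP[d0 d1].
have := t4_near_lt d0.
have := density4_near d0.
apply: filterS2 => n [_ _ st _] tn.
have /andP[c0 c1] : 0 <= c n <= 1 := density_ge0_le1 R C4 (T n).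
have {}tn : t n <= 1 / 2 + d by rewrite (le_trans (ltW tn)) // lerD2r.
move: st tn c0 c1; move: (c n) (t n) => x y st yd x0 x1.
(* Squaring preserves the order because [d <= 1 / 2] and [0 <= x] make the smaller base
   nonnegative. *)
have sq : (1 / 2 + x - d) ^+ 2 <= (1 + x - y) ^+ 2.
  by rewrite ler_pXn2r ?nnegrE //; lra.
have xd : 3 * x ^+ 2 - 5 * x + 3 / 4 <= 24 * d by nra.
(* The left side of [xd] is 3 (1/6 - x) (3/2 - x); if x < 1/6 - 6 d, it would exceed 3 * 6 d * 4/3 =
   24 d. *)
by rewrite leNgt; apply/negP => xlt; nra.
Qed.

Lemma c4_limn_inf_ge : 1 / 6 <= limn_inf (fun n => c n).
Proof.
apply/ler_addgt0Pr => d d0; rewrite -lerBlDr.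
apply: limn_inf_ge_near; first by move=> n; apply: density_ge0_le1.
(* The value d / 6 offsets the factor 6 in [c4_near_ge]; the cap 1 / 2 meets its hypothesis. *)
have d2 : 0 < Num.min (d / 6) (1 / 2) <= 1 / 2.
  by rewrite lt_min ge_min lexx orbT andbT; apply/andP; split; lra.
apply: filterS (c4_near_ge d2) => n; apply: le_trans.
have : Num.min (d / 6) (1 / 2) <= d / 6 by rewrite ge_min lexx.
by lra.
Qed.

Lemma t4_limn_inf_gt0 : 0 < limn_inf (fun n => t n).
Proof.
(* With d = 1 / 100, adding the source and sink bounds gives t >= c - 2 d >= 1/6 - 8 d > 8/100. *)
apply: (@lt_le_trans _ _ (8 / 100)) => //.
apply: limn_inf_ge_near; first by move=> n; apply: density_ge0_le1.
have d0 : 0 < 1 / 100 :> R by [].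
have d1 : 0 < (1 / 100 : R) <= 1 / 2 by apply/andP; split; lra.
by apply: filterS2 (density4_near d0) (c4_near_ge d1) => n [so si _ to] cn; lra.
Qed.

End Asymptotics.

(** * Universality and the limits for circular tournaments *)

Lemma universal4 (R : realType) (T : nat -> tournament) :
  #|T n| @[n --> \oo] --> \oo ->
  limn_sup (fun n => t4 R (T n)) < 1 / 2 -> universal R 4 T.
Proof.
move=> Too t_lt H H4.
(* The density of [H] depends only on its source and sink bits, so four cases remain. *)
have -> : (fun n => density R H (T n)) =
    (fun n => density R (standard4 (has_source H) (has_sink H)) (T n)).
  by apply/funext => n; rewrite density_standard4 density4E.
have t_le := ltW t_lt.
case: (has_source H) (has_sink H) => [] [].
- exact: t4_limn_inf_gt0.
- by apply: lt_le_trans (l4_limn_inf_ge R Too); rewrite subr_gt0.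
- by apply: lt_le_trans (w4_limn_inf_ge R Too); rewrite subr_gt0.
- by apply: lt_le_trans (c4_limn_inf_ge Too t_le).
Qed.

Lemma card_circular_seq_cvg : #|circular_seq k| @[k --> \oo] --> \oo.
Proof.
under eq_fun do rewrite card_circular_seq.
by move=> A [N _ NA]; exists N => // k /= Nk; apply: NA => /=; lia.
Qed.

(** The source inequality with [l4 = 0] bounds [t4] from below, and [t4_circular_le] bounds it from
    above. *)
Lemma t4_circular_cvg (R : realType) :
  t4 R (circular_seq k) @[k --> \oo] --> (1 / 2 : R).
Proof.
apply/cvgrPdist_le => e e0.
have := density4_near card_circular_seq_cvg e0.
have k2 : \forall k \near \oo, (2 <= k)%N by apply: nbhs_infty_ge.
move: k2; apply: filterS2 => k k2 [+ _ _ _].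
rewrite l4_circular addr0 => tk; have := t4_circular_le R k2.
by rewrite ler_norml => ?; apply/andP; split; lra.
Qed.

Theorem mainTheorem3 (R : realType) :
  (forall T : nat -> tournament,
     #|T n| @[n --> \oo] --> \oo ->
     [/\ limn_sup (fun n => t4 R (T n)) < 1 / 2 -> universal R 4 T,
         limn_inf (fun n => w4 R (T n)) >=
           1 / 2 - limn_sup (fun n => t4 R (T n)),
         limn_inf (fun n => l4 R (T n)) >=
           1 / 2 - limn_sup (fun n => t4 R (T n)) &
         limn_sup (fun n => t4 R (T n)) <= 1 / 2 ->
           limn_inf (fun n => c4 R (T n)) >= 1 / 6])
  /\ [/\ t4 R (circular_seq k) @[k --> \oo] --> (1 / 2 : R),
         l4 R (circular_seq k) @[k --> \oo] --> (0 : R) &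
         w4 R (circular_seq k) @[k --> \oo] --> (0 : R)].
Proof.
split=> [T Too|]; split.
- exact: universal4.
- exact: w4_limn_inf_ge.
- exact: l4_limn_inf_ge.
- exact: c4_limn_inf_ge.
- exact: t4_circular_cvg.
- by under eq_fun do rewrite l4_circular; apply: cvg_cst.
- by under eq_fun do rewrite w4_circular; apply: cvg_cst.
Qed.
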